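(* Let $n>3$ and let $C_n:(\sigma,\mu)$ be a strong fuzzy graph whose underlying crisp graph is the cycle on $n$ vertices and such that $\sigma$ is a $c$-constant function. Then $C_n$ is *-balanced.
   Context: A fuzzy graph $G:(\sigma,\mu)$ consists of a finite non-empty vertex set $V$, a function $\sigma:V\to(0,1]$, and a symmetric function $\mu:V\times V\to[0,1]$ with $\mu(u,v)\le \sigma(u)\wedge\sigma(v)$ for all $u,v$, where $\wedge$ denotes minimum. There are no loops: all conditions and sums over pairs $u,v\in V$ range over unordered pairs $\{u,v\}$ of distinct vertices. The underlying crisp graph of $G$ has vertex set $V$ and edge set $E=\{\{u,v\}:\mu(u,v)>0\}$. $G$ is strong if $\mu(u,v)=\sigma(u)\wedge\sigma(v)$ for all $\{u,v\}\in E$. $\sigma$ is a $c$-constant function if $\sigma(v)=c$ for all $v\in V$ (so $c\in(0,1]$). The *-density of $G$ is $D^{\ast}(G)=\dfrac{2\sum_{u,v\in V}\mu(u,v)}{\sum_{u\in V}\sigma(u)}$. A non-empty fuzzy subgraph of $G$ is a fuzzy graph $H:(\sigma',\mu')$ on a non-empty set $W\subseteq V$ with $\sigma'(u)\le\sigma(u)$ and $\mu'(u,v)\le\mu(u,v)$ for all $u,v\in W$. $G$ is *-balanced if $D^{\ast}(H)\le D^{\ast}(G)$ for all non-empty fuzzy subgraphs $H$ of $G$. *)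

(* Defs.v *)
From mathcomp Require Import all_boot all_order all_algebra.
From mathcomp Require Import reals.

Set Implicit Arguments.
Unset Strict Implicit.
Unset Printing Implicit Defensive.

Import Order.TTheory GRing.Theory Num.Theory.
Local Open Scope ring_scope.

(* Loops are excluded: the diagonal values [mu v v] are never used, and the
   bound by the vertex weights is only required off the diagonal. *)
Record fuzzy_graph (R : realType) (V : finType) := FuzzyGraph {
  sigma : V -> R;
  mu : V -> V -> R;
  fg_nonempty : (0 < #|V|)%N;
  fg_sigma_itv : forall v, 0 < sigma v <= 1;
  fg_mu_itv : forall u v, 0 <= mu u v <= 1;
  fg_mu_sym : forall u v, mu u v = mu v u;
  fg_mu_le : forall u v, u != v -> mu u v <= Num.min (sigma u) (sigma v)
}.

Definition crisp_edge (R : realType) (V : finType) (G : fuzzy_graph R V) :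
    rel V :=
  fun u v => (u != v) && (0 < mu G u v).

Definition strong (R : realType) (V : finType) (G : fuzzy_graph R V) : Prop :=
  forall u v, crisp_edge G u v -> mu G u v = Num.min (sigma G u) (sigma G v).

Definition constant_sigma (R : realType) (V : finType) (G : fuzzy_graph R V)
    (c : R) : Prop :=
  forall v, sigma G v = c.

(* Each unordered pair of distinct vertices is counted exactly once, through
   its representative (u, v) that is increasing for the enumeration of V. *)
Definition edge_weight (R : realType) (V : finType) (G : fuzzy_graph R V) : R :=
  \sum_(u : V) \sum_(v : V | (enum_rank u < enum_rank v)%N) mu G u v.

Definition star_density (R : realType) (V : finType) (G : fuzzy_graph R V) :
    R :=
  2 * edge_weight G / \sum_(u : V) sigma G u.

(* The vertex type of H is the subtype of V carved out by W, which is non-empty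
   because H is a fuzzy graph. *)
Definition fuzzy_subgraph (R : realType) (V : finType) (W : {set V})
    (H : fuzzy_graph R {x : V | x \in W}) (G : fuzzy_graph R V) : Prop :=
  (forall u, sigma H u <= sigma G (val u)) /\
  (forall u v, u != v -> mu H u v <= mu G (val u) (val v)).

Definition star_balanced (R : realType) (V : finType) (G : fuzzy_graph R V) :
    Prop :=
  forall (W : {set V}) (H : fuzzy_graph R {x : V | x \in W}),
    fuzzy_subgraph H G -> star_density H <= star_density G.

(* [ordS i] is i + 1 modulo n; this is the n-cycle for n >= 3. *)
Definition cycle_edge (n : nat) : rel 'I_n :=
  fun i j => (j == ordS i) || (i == ordS j).

Definition is_cycle (n : nat) (V : finType) (e : rel V) : Prop :=
  exists f : 'I_n -> V,
    bijective f /\ forall i j, e (f i) (f j) = cycle_edge i j.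

(* Main.v *)
Require Import Defs.
From mathcomp Require Import all_boot all_order all_algebra.
From mathcomp Require Import reals lra.

(** The statement holds for every strong fuzzy graph with constant vertex
weights whose crisp graph is d-regular, and the cycle is the case d = 2.

Summing the edge weights around each vertex counts every edge twice, so the
numerator of the density is a sum over ordered adjacent pairs
([double_edge_weight]). If all crisp degrees are at most d, the density is at
most d, whatever the weights ([star_density_le_degree]): each edge weight is
bounded by the mean of the weights of its two endpoints, so each vertex is
charged half its weight twice for each of its at most d edges. For a strong
d-regular graph with constant vertex weight these bounds are equalities and
the density is exactly d ([star_density_regular]). Passing to a fuzzy subgraph
cannot create crisp edges, hence does not raise degrees
([subgraph_degree_le]), so d bounds the density of every fuzzy subgraph of
such a graph ([regular_star_balanced]). *)

Set Implicit Arguments.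
Unset Strict Implicit.
Unset Printing Implicit Defensive.

Import Order.TTheory GRing.Theory Num.Theory.
Local Open Scope ring_scope.

Definition crisp_degree (R : realType) (V : finType) (G : fuzzy_graph R V)
    (u : V) : nat :=
  #|[pred v | crisp_edge G u v]|.

Lemma crisp_edge_sym (R : realType) (V : finType) (G : fuzzy_graph R V) :
  symmetric (crisp_edge G).
Proof. by move=> u v; rewrite /crisp_edge eq_sym fg_mu_sym. Qed.

Lemma sum_sigma_gt0 (R : realType) (V : finType) (G : fuzzy_graph R V) :
  0 < \sum_u sigma G u.
Proof.
have sigma_gt0 v : 0 < sigma G v by have /andP[] := fg_sigma_itv G v.
have /card_gt0P[x _] := fg_nonempty G.
rewrite (bigD1 x) //= ltr_wpDr //.
by apply: sumr_ge0 => i _; exact: ltW.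
Qed.

Lemma sum_neighbours (R : realType) (V : finType) (G : fuzzy_graph R V) (u : V) :
  \sum_(v | u != v) mu G u v = \sum_(v | crisp_edge G u v) mu G u v.
Proof.
rewrite [RHS]big_mkcondr; apply: eq_bigr => v _.
case: ifPn => //; rewrite -leNgt => mu_le0.
by have /andP[mu_ge0 _] := fg_mu_itv G u v; apply/eqP; rewrite eq_le mu_le0.
Qed.

(** Each unordered pair is split into its increasing and its decreasing
ordering; the two halves agree because mu is symmetric. *)
Lemma double_edge_weight (R : realType) (V : finType) (G : fuzzy_graph R V) :
  2 * edge_weight G = \sum_u \sum_(v | crisp_edge G u v) mu G u v.
Proof.
under [RHS]eq_bigr => u _ do rewrite -sum_neighbours
  (bigID (fun v => (enum_rank u < enum_rank v)%N)) /=.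
rewrite big_split /= mulr_natl mulr2n; congr (_ + _).
  apply: eq_bigr => u _; apply: eq_bigl => v.
  by case: eqVneq => [->|//]; rewrite ltnn.
rewrite /edge_weight (exchange_big_dep xpredT) //=.
apply: eq_bigr => u _; apply: eq_big => [v | v _]; last exact: fg_mu_sym.
by rewrite -leqNgt ltn_neqAle (inj_eq val_inj) (inj_eq enum_rank_inj) eq_sym.
Qed.

Lemma sum_sigma_over_edges (R : realType) (V : finType) (G : fuzzy_graph R V) :
  \sum_u \sum_(v | crisp_edge G u v) sigma G u =
  \sum_u (crisp_degree G u)%:R * sigma G u.
Proof.
by apply: eq_bigr => u _; rewrite sumr_const mulr_natl.
Qed.

(** The minimum of the two endpoint weights is at most their mean, so an edge
can be charged in equal shares to its endpoints; by symmetry every vertex u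
then pays its own weight once for each of its neighbours. *)
Lemma star_density_le_degree (R : realType) (V : finType)
    (G : fuzzy_graph R V) (d : nat) :
  (forall u, (crisp_degree G u <= d)%N) -> star_density G <= d%:R.
Proof.
move=> deg_le; rewrite /star_density ler_pdivrMr ?sum_sigma_gt0 //.
rewrite double_edge_weight.
have mu_le_mean u v : crisp_edge G u v ->
    mu G u v <= 2^-1 * sigma G u + 2^-1 * sigma G v.
  move=> /andP[neq_uv _]; have := fg_mu_le G neq_uv.
  by rewrite le_min => /andP[]; lra.
have swap : \sum_u \sum_(v | crisp_edge G u v) 2^-1 * sigma G v =
    \sum_u \sum_(v | crisp_edge G u v) 2^-1 * sigma G u.
  rewrite (exchange_big_dep xpredT) //=; apply: eq_bigr => u _.
  by apply: eq_bigl => v; rewrite crisp_edge_sym.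
apply: (@le_trans _ _ (\sum_u \sum_(v | crisp_edge G u v) sigma G u)).
  apply: (@le_trans _ _ (\sum_u \sum_(v | crisp_edge G u v)
      (2^-1 * sigma G u + 2^-1 * sigma G v))).
    by apply: ler_sum => u _; apply: ler_sum => v; exact: mu_le_mean.
  under eq_bigr => u _ do rewrite big_split /=.
  rewrite big_split /= swap -big_split /=.
  apply: ler_sum => u _; rewrite -big_split /=.
  by apply: ler_sum => v _; lra.
rewrite sum_sigma_over_edges mulr_sumr; apply: ler_sum => u _.
have /andP[sigma_gt0 _] := fg_sigma_itv G u.
by rewrite ler_pM2r // ler_nat.
Qed.

Lemma star_density_regular (R : realType) (V : finType)
    (G : fuzzy_graph R V) (c : R) (d : nat) :
  strong G -> constant_sigma G c -> (forall u, crisp_degree G u = d) ->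
  star_density G = d%:R.
Proof.
move=> strongG constG degE.
rewrite /star_density double_edge_weight.
have -> : \sum_u \sum_(v | crisp_edge G u v) mu G u v =
    \sum_u \sum_(v | crisp_edge G u v) sigma G u.
  apply: eq_bigr => u _; apply: eq_bigr => v /strongG ->.
  by rewrite !constG minxx.
rewrite sum_sigma_over_edges; under eq_bigr => u _ do rewrite degE.
by rewrite -mulr_sumr mulfK // gt_eqF // sum_sigma_gt0.
Qed.

Lemma subgraph_degree_le (R : realType) (V : finType) (W : {set V})
    (H : fuzzy_graph R {x : V | x \in W}) (G : fuzzy_graph R V) :
  fuzzy_subgraph H G ->
  forall x, (crisp_degree H x <= crisp_degree G (val x))%N.
Proof.
move=> [_ mu_le] x; rewrite /crisp_degree -(card_image val_inj).
apply/subset_leq_card/subsetP => _ /imageP[y /andP[neq_xy mu_gt0] ->].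
rewrite inE /crisp_edge (inj_eq val_inj) neq_xy /=.
exact: lt_le_trans mu_gt0 (mu_le _ _ neq_xy).
Qed.

Lemma regular_star_balanced (R : realType) (V : finType)
    (G : fuzzy_graph R V) (c : R) (d : nat) :
  strong G -> constant_sigma G c -> (forall u, crisp_degree G u = d) ->
  star_balanced G.
Proof.
move=> strongG constG degE W H subHG.
rewrite (star_density_regular strongG constG degE).
apply: star_density_le_degree => x.
by rewrite -(degE (val x)) subgraph_degree_le.
Qed.

(** The successor and the predecessor of a vertex coincide on a cycle of
length at most 2. *)
Lemma ordS_neq_pred (n : nat) (i : 'I_n) : (2 < n)%N -> ordS i != ord_pred i.
Proof.
move=> n_gt2; apply/eqP => /(congr1 (@ordS n)); rewrite ord_predK.
move=> /(congr1 val) /= /eqP.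
rewrite -addn1 modnDml addn1 -addn2 -{2}(modn_small (ltn_ord i)).
by rewrite -{2}(addn0 i) eqn_modDl mod0n modn_small.
Qed.

Lemma card_cycle_edge (n : nat) (i : 'I_n) :
  (2 < n)%N -> #|[pred j | cycle_edge i j]| = 2.
Proof.
move=> n_gt2; transitivity #|pred2 (ordS i) (ord_pred i)|.
  apply: eq_card => j; rewrite !inE /cycle_edge; congr (_ || _).
  by rewrite -[RHS](inj_eq (@ordS_inj n)) ord_predK eq_sym.
by rewrite card2 ordS_neq_pred.
Qed.

Lemma cycle_crisp_degree (R : realType) (n : nat) (V : finType)
    (G : fuzzy_graph R V) :
  (2 < n)%N -> is_cycle n (crisp_edge G) -> forall u, crisp_degree G u = 2.
Proof.
move=> n_gt2 [f [f_bij fE]] u; have [g fK gK] := f_bij.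
rewrite -(gK u) -(card_cycle_edge (g u) n_gt2) -(card_image (can_inj fK)).
apply: eq_card => v; rewrite -(gK v) (mem_image (can_inj fK)).
by rewrite !inE fE.
Qed.

Theorem theorem9 (R : realType) (n : nat) (V : finType) (c : R)
    (G : fuzzy_graph R V) (hn : (3 < n)%N) (hstrong : strong G)
    (hcycle : is_cycle n (crisp_edge G)) (hconst : constant_sigma G c) :
  star_balanced G.
Proof.
exact: regular_star_balanced hstrong hconst (cycle_crisp_degree (ltnW hn) hcycle).
Qed.
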